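(* Let $\mathcal H=\mathcal H_1\oplus\mathcal H_2$ with $d_1=\dim\mathcal H_1\ge2$ and $d_2=\dim\mathcal H_2\ge1$ finite, let $B$ be a finite index set, and suppose $$G=\{U_{b,\sigma}=U_{1,b}\oplus\sigma U_{2,b}:\ b\in B,\ \sigma=\pm1\}$$ is a group of unitaries on $\mathcal H$ (the pairs $(b,\sigma)$ indexing distinct elements), where $U_{\alpha,b}$ is a unitary on $\mathcal H_\alpha$. Let $G_\alpha=\{U_{\alpha,b}:b\in B\}$ for $\alpha=1,2$. (1) If $G_1$ and $G_2$ are unitary $1$-designs on $\mathcal H_1$ and $\mathcal H_2$ respectively, then the only trivial irreducible subrepresentations in the natural representation $U\mapsto U\otimes U^*$ of $G$ on $\mathcal H\otimes\mathcal H$ are those spanned by $|\mathbb 1_1\rangle\rangle$ and $|\mathbb 1_2\rangle\rangle$; i.e. the trivial isotypic component is $\operatorname{span}\{|\mathbb 1_1\rangle\rangle,|\mathbb 1_2\rangle\rangle\}$. (2) If in addition $G_1$ and $G_2$ are unitary $2$-designs and $d_1\ne d_2$, then the orthogonal complement $\mathcal H_{1\perp}$ of $|\mathbb 1_1\rangle\rangle$ in $\mathcal H_1\otimes\mathcal H_1$ is an irreducible representation of $G$ and occurs with multiplicity $1$ in the natural representation.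
   Context: A matrix $A=\sum A_{kl}|k\rangle\langle l|$ is identified with $|A\rangle\rangle=\sum A_{kl}|k\rangle\otimes|l\rangle\in\mathcal H\otimes\mathcal H$; $\mathbb 1_\alpha$ is the orthogonal projector onto $\mathcal H_\alpha$. A finite family $\mathcal S$ of unitaries on a space $\mathcal K$ is a unitary $t$-design if for every balanced polynomial $p(U,U^* )$ of degree at most $t$ (a polynomial in the entries of $U$ and $U^*$ in which each term has the same degree $\le t$ in the entries of $U$ as in those of $U^*$) one has $\frac1{|\mathcal S|}\sum_{U\in\mathcal S}p(U,U^* )=\int dU\,p(U,U^* )$, the integral being over the normalized Haar measure on the full unitary group of $\mathcal K$. Here $G_\alpha$ is averaged as the family indexed by $b\in B$. *)

(* Defs.v *)
From HB Require Import structures.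
From mathcomp Require Import all_boot all_order all_algebra all_fingroup.
From mathcomp Require Import mxrepresentation sesquilinear spectral.
From mathcomp Require Import all_classical all_reals all_analysis.
From mathcomp Require Import complex mxtens.
From mathcomp Require mpoly.

Set Implicit Arguments.
Unset Strict Implicit.
Unset Printing Implicit Defensive.

Import Order.TTheory GRing.Theory Num.Theory Num.Def.
Import numFieldNormedType.Exports.

Local Open Scope classical_set_scope.
Local Open Scope ring_scope.
Local Open Scope complex_scope.

Section HaarMeasure.
Variables (R : realType) (d : nat).

(* d x d complex matrices with their Borel sigma-algebra; the regular module
   R[i]^o is R[i] carrying the topology of its modulus. *)
Definition borel_mx := g_sigma_algebraType (@open 'M[R[i]^o]_d).

Definition unitary_group : set borel_mx := [set V : 'M[R[i]]_d | V \is unitarymx].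

(* The normalized Haar measure of the compact group U(d), seen as a Borel
   probability measure on matrices that is carried by U(d). *)
Definition is_haar (mu : probability borel_mx R) : Prop :=
  mu unitary_group = 1%E /\
  forall U : 'M[R[i]]_d, U \is unitarymx ->
  forall A : set borel_mx, measurable A ->
    mu ((fun V : 'M[R[i]]_d => U *m V) @^-1` A) = mu A.

Definition haar_integral (mu : probability borel_mx R) (f : 'M[R[i]]_d -> R[i])
    : R[i] :=
  Complex (Rintegral mu unitary_group (fun V => complex.Re (f V)))
          (Rintegral mu unitary_group (fun V => complex.Im (f V))).

End HaarMeasure.

Section UnitaryDesign.
Variables (R : realType) (d : nat).

(* Polynomials p(U, U^* ) have d * d variables for the entries of U, followed by
   d * d variables for their complex conjugates. *)
Notation upoly := (mpoly.mpoly (d * d + d * d) R[i]).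

Definition ueval (p : upoly) (U : 'M[R[i]]_d) : R[i] :=
  mpoly.meval (row_mx (mxvec U) (mxvec (map_mx conjC U)) 0) p.

Definition balanced (t : nat) (p : upoly) : Prop :=
  forall m : mpoly.multinom (d * d + d * d), mpoly.mcoeff m p != 0 ->
    let degU := (\sum_(i < d * d) mpoly.fun_of_multinom m (lshift _ i))%N in
    let degUconj := (\sum_(i < d * d) mpoly.fun_of_multinom m (rshift _ i))%N in
    degU = degUconj /\ (degU <= t)%N.

(* The family is averaged over its index set, with multiplicities. *)
Definition unitary_design (mu : probability (borel_mx R d) R) (t : nat)
    (B : finType) (U : B -> 'M[R[i]]_d) : Prop :=
  (forall b, U b \is unitarymx) /\
  forall p : upoly, balanced t p ->
    #|B|%:R^-1 * (\sum_b ueval p (U b)) = haar_integral mu (ueval p).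

End UnitaryDesign.

Section Representations.
Variables (F : fieldType) (gT : finGroupType) (G : {group gT}).

(* MathComp modules consist of row vectors acted on from the right.  The left
   action v |-> rho g *m v on columns is the right action of g^-1 on the
   transposed vectors, so that the subrepresentations of rho on column vectors
   are, up to transposition, the submodules of the following representation. *)
Definition colmod_mx n (rho : mx_representation F G n) (g : gT) : 'M[F]_n :=
  (rho g^-1%g)^T.

Lemma colmod_mx_repr n (rho : mx_representation F G n) :
  mx_repr G (colmod_mx rho).
Proof.
split=> [|g h Gg Gh]; first by rewrite /colmod_mx invg1 repr_mx1 trmx1.
by rewrite /colmod_mx invMg repr_mxM ?groupV// trmx_mul.
Qed.

Canonical colmod_repr n (rho : mx_representation F G n) :=
  MxRepresentation (colmod_mx_repr rho).

(* Irreducible subrepresentations on which G acts trivially. *)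
Definition trivial_simple n (rG : mx_representation F G n) (W : 'M[F]_n) : Prop :=
  mxsimple rG W /\ (W <= rfix_mx rG G)%MS.

End Representations.

(* Multiplicity of the simple module W in rG: the rank of its isotypic component
   divided by the rank of a simple constituent of that component. *)
Definition multiplicity (F : decFieldType) (gT : finGroupType) (G : {group gT})
    (n : nat) (rG : mx_representation F G n) (W : 'M[F]_n)
    (simW : mxsimple rG W) : nat :=
  socle_mult (PackSocle (component_socle (DecSocleType rG) simW)).

Section NaturalRepresentation.
Variables (C : numClosedFieldType) (gT : finGroupType) (G : {group gT}).
Variables (n : nat) (rG : mx_representation C G n).

(* U (x) U^*, with U^* the entrywise complex conjugate; it maps |A>> to
   |U A U^dagger>>. *)
Definition natural_mx (g : gT) : 'M[C]_(n * n) := rG g *t map_mx conjC (rG g).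

Lemma natural_mx_repr : mx_repr G natural_mx.
Proof.
split=> [|g h Gg Gh]; rewrite /natural_mx.
  rewrite repr_mx1 map_mx1; apply/matrixP=> i j.
  case: (mxtens_indexP i) (mxtens_indexP j) => i1 i2 [j1 j2].
  rewrite tensmxE !mxE (can_eq (@mxtens_indexK _ _)) xpair_eqE.
  by case: eqP; case: eqP; rewrite ?mulr0 ?mul0r ?mulr1.
by rewrite repr_mxM// map_mxM tensmx_mul.
Qed.

Canonical natural_repr := MxRepresentation natural_mx_repr.

End NaturalRepresentation.

(* |A>> = \sum_(k, l) A k l |k> (x) |l> *)
Definition ketket (C : numClosedFieldType) (n : nat) (A : 'M[C]_n) : 'cV[C]_(n * n) :=
  \sum_k \sum_l A k l *: (delta_mx k 0 *t delta_mx l 0 : 'M[C]_(n * n, 1 * 1)).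

Section BlockGroup.
Variables (R : realType) (d1 d2 : nat).

(* The sign sigma of U_{b,sigma} is encoded by a boolean, true for -1. *)
Definition block_unitary (B : finType) (U1 : B -> 'M[R[i]]_d1)
    (U2 : B -> 'M[R[i]]_d2) (x : B * bool) : 'M[R[i]]_(d1 + d2) :=
  block_mx (U1 x.1) 0 0 ((-1) ^+ x.2 *: U2 x.1).

Definition id1 : 'M[R[i]]_(d1 + d2) := block_mx 1%:M 0 0 0.
Definition id2 : 'M[R[i]]_(d1 + d2) := block_mx 0 0 0 1%:M.

(* Subspaces of column vectors, as row spaces of the transposed vectors. *)
Definition line1 := <<(ketket id1)^T>>%MS.
Definition line2 := <<(ketket id2)^T>>%MS.

(* H_1 (x) H_1 is the range of the projector id1 *t id1. *)
Definition H1perp : 'M[R[i]]_((d1 + d2) * (d1 + d2)) :=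
  ((id1 *t id1)^T :&: orthomx conjC 1%:M (ketket id1)^T)%MS.

End BlockGroup.

(* Main.v *)
Require Import Defs.
From HB Require Import structures.
From mathcomp Require Import all_boot all_order all_algebra all_fingroup.
From mathcomp Require Import mxrepresentation sesquilinear spectral.
From mathcomp Require Import all_classical all_reals all_analysis.
From mathcomp Require Import complex mxtens.
From mathcomp Require Import ring.
From mathcomp Require mpoly.

(* The conjugation action A |-> U A U^* on matrices is the natural representation.
   A design property equates an average over the family with a Haar integral,
   and the Haar integral is invariant under V |-> W V for every unitary W; hence
   averages of balanced polynomials are unchanged when all U_b are replaced by
   W U_b.  For a 1-design this makes every matrix that commutes with the U_b
   commute with all unitaries, so it is scalar.  For a 2-design, applied to
   V |-> |tr (X V A V^* )|^2, it shows that if X annihilates all U_b A U_b^*, then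
   it annihilates W A W^* for all unitaries W, and then X or A is scalar; dually,
   the U_b A U_b^* span all traceless matrices as soon as A is traceless and
   nonzero, which is the irreducibility.

   The element 1 (+) -1 of the group kills off-diagonal blocks of its fixed
   vectors.  So a fixed vector is a sum of two scalar blocks, and a copy of the
   traceless part of the first block is block diagonal; its projection to the
   second block is zero because the traceless part of that block is zero or
   irreducible of dimension d2^2 - 1 <> d1^2 - 1. *)

Set Implicit Arguments.
Unset Strict Implicit.
Unset Printing Implicit Defensive.

Import Order.TTheory GRing.Theory Num.Theory.
Local Open Scope ring_scope.

(** * Conjugation by all unitaries *)

Lemma sum_normr_sqr_eq0 (R : numDomainType) (I : finType) (x : I -> R) :
  \sum_i `|x i| ^+ 2 = 0 -> forall i, x i = 0.
Proof.
move=> x0 i; apply/eqP; rewrite -normr_eq0 -sqrf_eq0.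
move/eqP: x0; rewrite psumr_eq0 => [/allP/(_ i)|j _]; last by rewrite exprn_ge0.
by rewrite mem_index_enum => /(_ isT).
Qed.

Section UnitaryConjugation.
Import Num.Def.
Local Open Scope sesquilinear_scope.
Variables (C : numClosedFieldType) (n : nat).
Implicit Types (A X Y Q W : 'M[C]_n) (i j k l : 'I_n).

(** The split matters because commutators with diagonal matrix units can isolate an off-diagonal
    entry, while a diagonal matrix must first be given one. *)
Lemma not_scalar_mxP A : ~~ is_scalar_mx A ->
  (exists i j, i != j /\ A i j != 0) \/
  (is_diag_mx A /\ exists i j, A i i != A j j).
Proof.
move=> nsA; have [dA|ndA] := boolP (is_diag_mx A); last first.
  left; case: (boolP [exists i, exists j, (i != j) && (A i j != 0)]).
    by move=> /existsP[i /existsP[j /andP[]]]; exists i, j.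
  move/existsPn => A0; case/negP: ndA; apply/is_diag_mxP => i j ij.
  by move/existsPn: (A0 i) => /(_ j); rewrite ij negbK => /eqP.
right; split=> //.
case: (boolP [exists i, exists j, A i i != A j j]).
  by move=> /existsP[i /existsP[j]]; exists i, j.
move/existsPn => eqA; case/negP: nsA.
case: n A dA eqA => [|m] A dA eqA.
  by apply/is_scalar_mxP; exists 0; apply/matrixP => -[].
apply/is_scalar_mxP; exists (A ord0 ord0); apply/matrixP => i j; rewrite !mxE.
have [<-|ij] := eqVneq i j; last by move/is_diag_mxP: dA => ->.
by move/existsPn: (eqA i) => /(_ ord0)/negPn/eqP ->.
Qed.

Lemma conjC_trmxK m p (M : 'M[C]_(m, p)) : (M ^t*) ^t* = M.
Proof. by apply/matrixP => i j; rewrite !mxE conjCK. Qed.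

Lemma conjC_trmx_mul m p q (M : 'M[C]_(m, p)) (N : 'M[C]_(p, q)) :
  (M *m N) ^t* = N ^t* *m M ^t*.
Proof. by rewrite trmx_mul map_mxM. Qed.

Lemma unitarymx_adj W : W \is unitarymx -> W ^t* *m W = 1%:M.
Proof. by move/unitarymxP; exact: mulmx1C. Qed.

Lemma mxtrace_conjC_trmx A : \tr (A ^t*) = (\tr A)^*.
Proof. by rewrite rmorph_sum /=; apply: eq_bigr => i _; rewrite !mxE. Qed.

(** Left translation of [V] by [W] amounts to a change of the test matrix [X], so translates of
    trace polynomials are again trace polynomials. *)
Lemma mxtrace_translate W V A X :
  \tr ((W ^t* *m X *m W) *m (V *m A *m V ^t*)) =
  \tr (X *m ((W *m V) *m A *m (W *m V) ^t*)).
Proof. by rewrite conjC_trmx_mul -!mulmxA mxtrace_mulC -!mulmxA. Qed.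

(** Conjugating a trace polynomial gives another one, which makes its squared modulus a polynomial
    in the entries of [V] and their conjugates. *)
Lemma mxtrace_conjC_pairing X A V :
  \tr (X ^t* *m (V *m A ^t* *m V ^t*)) = (\tr (X *m (V *m A *m V ^t*)))^*.
Proof.
rewrite -mxtrace_conjC_trmx !conjC_trmx_mul conjC_trmxK mxtrace_mulC.
by rewrite !mulmxA.
Qed.

Lemma scalar_unitary_conj W A :
  W \is unitarymx -> is_scalar_mx (W *m A *m W ^t*) -> is_scalar_mx A.
Proof.
move=> uW /is_scalar_mxP[a Ea]; apply/is_scalar_mxP; exists a.
have -> : A = W ^t* *m (W *m A *m W ^t*) *m W.
  by rewrite !mulmxA unitarymx_adj // mul1mx -mulmxA unitarymx_adj // mulmx1.
by rewrite Ea scalar_mxC -mulmxA unitarymx_adj // mulmx1.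
Qed.

Definition unitary_stable (K : 'M[C]_n -> Prop) : Prop :=
  (forall a X Y, K X -> K Y -> K (a *: X + Y)) /\
  (forall W X, W \is unitarymx -> K X -> K (W *m X *m W ^t*)).

Lemma stable0 K X : unitary_stable K -> K X -> K 0.
Proof.
move=> [Klin _] KX; have -> : 0 = (-1) *: X + X by rewrite scaleN1r addNr.
exact: Klin.
Qed.

(** The matrix multiplies the range of the orthogonal projector [Q] by the phase [z] and fixes its
    orthogonal complement. *)
Lemma unitary_phase Q (z : C) : Q ^t* = Q -> Q *m Q = Q -> z * z^* = 1 ->
  (1%:M + (z - 1) *: Q) \is unitarymx.
Proof.
move=> Qh Qi zz; apply/unitarymxP.
rewrite linearD /= linearZ /= map_mxD map_mxZ /= Qh trmx1 map_mx1.
rewrite mulmxDl mul1mx mulmxDr mulmx1 -scalemxAl -scalemxAr Qi.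
rewrite scalerA -!addrA -!scalerDl rmorphB rmorph1.
rewrite [X in X *: Q](_ : _ = z * z^* - 1); last by ring.
by rewrite zz subrr scale0r addr0.
Qed.

(* For the phases ['i] and [-'i] the conjugates of [X] by [1 + (z - 1) Q] differ
   by a multiple of the commutator. *)
Lemma stable_commutator K Q X : unitary_stable K ->
  Q ^t* = Q -> Q *m Q = Q -> K X -> K (Q *m X - X *m Q).
Proof.
move=> stK Qh Qi KX; have [Klin Kconj] := stK.
pose W (z : C) : 'M[C]_n := 1%:M + (z - 1) *: Q.
have conjE z : W z *m X *m (W z)^t* = X + (z - 1) *: (Q *m X)
    + (z^* - 1) *: (X *m Q) + ((z - 1) * (z^* - 1)) *: (Q *m X *m Q).
  rewrite /W linearD /= linearZ /= map_mxD map_mxZ /= Qh trmx1 map_mx1.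
  rewrite mulmxDl mul1mx mulmxDr mulmx1 !mulmxDl -!scalemxAl -!scalemxAr.
 by rewrite scalerA rmorphB rmorph1 !addrA.
have KW z : z * z^* = 1 -> K (W z *m X *m (W z)^t*).
  by move=> zz; apply: Kconj => //; exact: unitary_phase.
have i1 : 'i * ('i)^* = 1 :> C by rewrite conjCi mulrN -expr2 sqrCi opprK.
have i2 : (- 'i) * (- 'i)^* = 1 :> C by rewrite rmorphN mulrNN.
have conjCNi : (- 'i)^* = 'i :> C by rewrite rmorphN /= conjCi opprK.
have i0 : 'i + 'i != 0 :> C by rewrite -mulr2n mulrn_eq0 /= neq0Ci.
have K0 : K 0 by exact: stable0 stK KX.
have -> : Q *m X - X *m Q = ('i + 'i)^-1 *:
   ((-1) *: (W (- 'i) *m X *m (W (- 'i))^t*) + W 'i *m X *m (W 'i)^t*) + 0.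
  rewrite !conjE conjCNi conjCi addr0; apply/matrixP => i j; rewrite !mxE.
  move: (\sum_k _) (\sum_k _) (\sum_k _) => a b c; field; exact: i0.
by apply: (Klin) => //; apply: (Klin); exact: KW.
Qed.

(** Commutators with diagonal matrix units rescale each entry by 1, 0 or -1, so nesting them selects
    entries. *)
Lemma commutator_deltaE i X k l :
  (delta_mx i i *m X - X *m delta_mx i i) k l =
    ((k == i)%:R - (l == i)%:R) * X k l.
Proof.
rewrite !mxE (bigD1 i) //= big1; last first.
  by move=> m mi; rewrite !mxE (negPf mi) andbF mul0r.
rewrite [X in _ - X](bigD1 i) //= [X in _ - (_ + X)]big1; last first.
  by move=> m mi; rewrite !mxE (negPf mi) mulr0.
rewrite !mxE !eqxx /= andbT !addr0 mulrBl.
have [->|ki] := eqVneq k i; have [->|li] := eqVneq l i;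
  by rewrite ?mul1r ?mulr1 ?mul0r ?mulr0.
Qed.

Lemma stable_delta K X i j : unitary_stable K ->
  K X -> i != j -> X i j != 0 -> K (delta_mx i j).
Proof.
move=> stK KX ij Xij; have [Klin _] := stK.
have Kd k Y : K Y -> K (delta_mx k k *m Y - Y *m delta_mx k k).
  apply: stable_commutator => //; last by rewrite mul_delta_mx.
  by rewrite trmx_delta map_delta_mx.
(* [Z] keeps only the entries at [(i, j)] and [(j, i)], both negated. [T] restores the sign of the
   second, so [T + Z] is [-2 X i j] times the matrix unit. *)
pose Y := delta_mx j j *m X - X *m delta_mx j j.
pose Z := delta_mx i i *m Y - Y *m delta_mx i i.
pose T := delta_mx i i *m Z - Z *m delta_mx i i.
have KZ : K Z by exact/Kd/Kd.
have KT : K T by exact: Kd.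
have K0 : K 0 by exact: stable0 stK KX.
have -> : delta_mx i j = (- (X i j + X i j))^-1 *: (1 *: T + Z) + 0.
  apply/matrixP => k l; rewrite addr0 scale1r [RHS]mxE [X in _ * X]mxE.
  rewrite /T commutator_deltaE /Z commutator_deltaE /Y commutator_deltaE.
  have X2 : X i j + X i j != 0 by rewrite -mulr2n mulrn_eq0.
  rewrite mxE; have [->|ki] := eqVneq k i; last first.
    by case: (l == i); rewrite /= ?sub0r ?subrr; ring.
  rewrite (negPf ij) /=; have [->|lj] := eqVneq l j.
    by rewrite eq_sym (negPf ij) /=; field; exact: X2.
  by rewrite /= mulr0n; ring.
by apply: (Klin) => //; exact: Klin.
Qed.

Lemma stable_not_scalar K X : unitary_stable K -> K X -> ~~ is_scalar_mx X ->
  exists i j, i != j /\ K (delta_mx i j).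
Proof.
move=> stK KX /not_scalar_mxP[[i [j [ij Xij]]]|[dX [i [j Xij]]]].
  by exists i, j; split=> //; exact: stable_delta Xij.
have ij : i != j by apply: contraNneq Xij => ->.
exists i, j; split=> //.
(* [Q] projects onto the line spanned by the sum of the basis vectors [i] and [j]. Its commutator
   with the diagonal [X] has [(i, j)] entry [(X j j - X i i) / 2]. *)
pose v : 'rV[C]_n := delta_mx 0 i + delta_mx 0 j.
pose Q : 'M[C]_n := 2^-1 *: (v^T *m v).
have vv : v *m v^T = 2%:M.
  rewrite /v linearD /= !trmx_delta mulmxDl !mulmxDr !mul_delta_mx_cond.
  rewrite !eqxx [j == i]eq_sym (negPf ij) !mulr1n !mulr0n addr0 add0r.
  by apply/matrixP => a b; rewrite !ord1 !mxE.
have vr : map_mx conjC v = v.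
  by rewrite /v map_mxD !map_delta_mx.
have Qh : Q ^t* = Q.
  rewrite /Q linearZ /= map_mxZ trmx_mul trmxK map_mxM -map_trmx vr.
  by rewrite fmorphV rmorph_nat.
have Qi : Q *m Q = Q.
  rewrite /Q -scalemxAl -scalemxAr scalerA mulmxA -[v^T *m v *m v^T]mulmxA vv.
  rewrite -scalemx1 -scalemxAr mulmx1 -scalemxAl scalerA; congr (_ *: _).
  by field.
have KQ := stable_commutator stK Qh Qi KX.
apply: (stable_delta stK KQ ij).
rewrite !mxE (bigD1 j) //= big1 ?addr0; last first.
  by move=> k kj; move/is_diag_mxP: dX => ->; rewrite ?mulr0.
rewrite [X in _ - X](bigD1 i) //= [X in _ - (_ + X)]big1 ?addr0; last first.
  by move=> k ki; move/is_diag_mxP: dX => ->; rewrite ?mul0r // eq_sym.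
have Qij : Q i j = 2^-1.
  rewrite !mxE big_ord1 !mxE !eqxx [j == i]eq_sym (negPf ij) /=.
  by rewrite addr0 add0r !mulr1.
by rewrite Qij mulrC -mulrBl mulf_neq0 ?invr_eq0 ?pnatr_eq0 // subr_eq0 eq_sym.
Qed.

Lemma mxtrace_mul_delta X i j : \tr (X *m delta_mx i j) = X j i.
Proof.
rewrite /mxtrace (bigD1 j) //= big1 ?addr0 => [|k kj]; rewrite mxE.
  rewrite (bigD1 i) //= big1 ?addr0 => [|k ki]; rewrite mxE ?eqxx ?mulr1 //.
  by rewrite (negPf ki) mulr0.
by rewrite big1 // => l _; rewrite mxE (negPf kj) andbF mulr0.
Qed.

Lemma perm_mx_conjC_trmx (s : 'S_n) :
  (perm_mx s : 'M[C]_n) ^t* = perm_mx s^-1%g.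
Proof. by rewrite tr_perm_mx map_perm_mx. Qed.

Lemma perm_mx_unitary (s : 'S_n) : (perm_mx s : 'M[C]_n) \is unitarymx.
Proof.
by apply/unitarymxP; rewrite perm_mx_conjC_trmx -perm_mxM mulgV perm_mx1.
Qed.

(** For fixed [X] the matrices [A] satisfying the hypothesis form a stable set, and symmetrically
    for fixed [A]. If neither is scalar, both can be replaced by off-diagonal matrix units, which
    some permutation matrix pairs to 1. *)
Lemma not_scalar_pairing A X :
  (forall W, W \is unitarymx -> \tr (X *m (W *m A *m W ^t*)) = 0) ->
  is_scalar_mx A \/ is_scalar_mx X.
Proof.
move=> XA; have [|nsA] := boolP (is_scalar_mx A); first by left.
have [|nsX] := boolP (is_scalar_mx X); first by right.
have [|||i [j [ij Kij]]] := @stable_not_scalar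
    (fun Y => forall W, W \is unitarymx -> \tr (X *m (W *m Y *m W ^t*)) = 0) A.
- split=> [a Y Z KY KZ W uW|V Y uV KY W uW].
    rewrite mulmxDr mulmxDl mulmxDr mxtraceD -scalemxAr -scalemxAl -scalemxAr.
    by rewrite mxtraceZ KY // KZ // mulr0 addr0.
  have -> : W *m (V *m Y *m V^t*) *m W^t* = (W *m V) *m Y *m (W *m V)^t*.
    by rewrite conjC_trmx_mul !mulmxA.
  by rewrite KY // mul_unitarymx.
- exact: XA.
- exact: nsA.
have [|||k [l [kl Kkl]]] := @stable_not_scalar
    (fun Y => forall W, W \is unitarymx ->
       \tr (Y *m (W *m delta_mx i j *m W ^t*)) = 0) X.
- split=> [a Y Z KY KZ W uW|V Y uV KY W uW].
    by rewrite mulmxDl mxtraceD -scalemxAl mxtraceZ KY // KZ // mulr0 addr0.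
  rewrite -!mulmxA mxtrace_mulC -!mulmxA.
  have -> : V^t* *m (W *m (delta_mx i j *m (W^t* *m V))) =
      (V^t* *m W) *m delta_mx i j *m (V^t* *m W)^t*.
    by rewrite conjC_trmx_mul conjC_trmxK !mulmxA.
  by rewrite KY // mul_unitarymx // trmxC_unitary.
- exact: Kij.
- exact: nsX.
(* Chosen so that [s k = j] and [s l = i]: conjugation then carries the unit at [(i, j)] to the one
   at [(l, k)], dual to [(k, l)]. *)
pose s : 'S_n := (tperm l i * tperm (tperm l i k) j)%g.
have sk : s k = j by rewrite permM tpermL.
have sl : s l = i.
  rewrite permM tpermL; apply: tpermD; last by rewrite eq_sym.
  by apply: contraNneq kl => /(congr1 (tperm l i)); rewrite tpermK tpermR => ->.
move/eqP: (Kkl _ (perm_mx_unitary s)); rewrite mxtrace_mulC mxtrace_mul_delta.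
rewrite perm_mx_conjC_trmx -col_permE -row_permE !mxE sk sl !eqxx /=.
by rewrite oner_eq0.
Qed.

(** The multiples of [A] form a stable set. If [A] were not scalar, some off-diagonal matrix unit
    would be a multiple of [A], hence invariant, and would pair to 0 with all its conjugates. *)
Lemma unitary_invariant_scalar A :
  (forall W, W \is unitarymx -> W *m A *m W ^t* = A) -> is_scalar_mx A.
Proof.
move=> Ainv; apply/negPn/negP => nsA.
have [|||i [j [ij [a Ea]]]] := @stable_not_scalar
    (fun Y => exists a, Y = a *: A) A.
- split=> [a _ _ [b ->] [c ->]|W _ uW [b ->]].
    by exists (a * b + c); rewrite scalerA scalerDl.
  by exists b; rewrite -scalemxAr -scalemxAl Ainv.
- by exists 1; rewrite scale1r.
- exact: nsA.
have nsE : ~~ is_scalar_mx (delta_mx i j : 'M[C]_n).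
  apply/negP => /is_scalar_mxP[c /matrixP/(_ i j)].
  by rewrite !mxE !eqxx (negPf ij) => /eqP; rewrite oner_eq0.
have [W uW||] := @not_scalar_pairing (delta_mx i j) (delta_mx i j).
- rewrite {2}Ea -scalemxAr -scalemxAl Ainv // -Ea.
  by rewrite mxtrace_mul_delta mxE [j == i]eq_sym (negPf ij).
- by rewrite (negPf nsE).
- by rewrite (negPf nsE).
Qed.

End UnitaryConjugation.

(** * Haar integrals and averages over designs *)

Section SimpleFunctionComposition.
Local Open Scope classical_set_scope.
Import HBNNSimple.
Context {disp : measure_display} {T : measurableType disp} {R : realType}.
Variables (phi : T -> T) (mphi : measurable_fun setT phi) (h : {nnsfun T >-> R}).

Let hphi := h \o phi.

Let hphi_ge0 x : 0 <= hphi x. Proof. exact: fun_ge0. Qed.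
HB.instance Definition _ := @isNonNegFun.Build _ _ hphi hphi_ge0.

Let hphi_meas : measurable_fun setT hphi.
Proof. by apply: measurableT_comp. Qed.
HB.instance Definition _ := @isMeasurableFun.Build _ _ _ _ hphi hphi_meas.

Let hphi_fin : finite_set (range hphi).
Proof.
apply: (@sub_finite_set _ _ (range h)); last exact: fimfunP.
by move=> _ [x _ <-]; exists (phi x).
Qed.
HB.instance Definition _ := @FiniteImage.Build _ _ hphi hphi_fin.

Definition nnsfun_comp : {nnsfun T >-> R} := hphi.

End SimpleFunctionComposition.

Section InvariantIntegral.
Local Open Scope classical_set_scope.
Import HBNNSimple.
Context {disp : measure_display} {T : measurableType disp} {R : realType}.
Variable mu : {measure set T -> \bar R}.

Definition measure_preserving (phi : T -> T) : Prop :=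
  measurable_fun setT phi /\
  forall A, measurable A -> mu (phi @^-1` A) = mu A.

(** A simple function below [f], composed with [phi], lies below the composite of [f] and has the
    same integral, since its level sets keep their measure. *)
Lemma ge0_integral_le_comp (phi : T -> T) (f : T -> \bar R) :
  measure_preserving phi -> (forall x, 0 <= f x)%E ->
  (\int[mu]_x f x <= \int[mu]_x f (phi x))%E.
Proof.
move=> [mphi muphi] f0.
rewrite !ge0_integralTE//; apply: le_ereal_sup => _ [h /= hf <-].
exists (nnsfun_comp mphi h) => /=; first by move=> x; exact: hf.
rewrite !sintegralET; apply: eq_fsbigr => r _; congr (_ * _)%E.
exact: (muphi (h @^-1` [set r]) (measurable_funPTI h (measurable_set1 r))).
Qed.

(* The integral is a supremum over the simple functions below [f], on which an
   invertible [phi] acts by composition. *)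
Lemma Rintegral_comp_invariant (phi psi : T -> T) (D : set T) (f : T -> R) :
  measure_preserving phi -> measure_preserving psi ->
  cancel psi phi -> phi @^-1` D = D ->
  Rintegral mu D (f \o phi) = Rintegral mu D f.
Proof.
move=> Pphi Ppsi K DE; congr fine.
have ge0 (g : T -> \bar R) : (forall x, 0 <= g x)%E ->
    (\int[mu]_x g (phi x) = \int[mu]_x g x)%E.
  move=> g0; apply/eqP; rewrite eq_le ge0_integral_le_comp// andbT.
  (* The reverse inequality is the same lemma for [psi] and [g \o phi], as [phi \o psi] is the
     identity. *)
  apply: le_trans (ge0_integral_le_comp Ppsi _) _ => //.
  by under eq_fun do rewrite K.
(* Extension by zero outside [D] commutes with composition because [D] is its own preimage; positive
   and negative parts are then compared separately. *)
rewrite [LHS]integral_mkcond [RHS]integral_mkcond.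
have -> : ((fun x => ((f \o phi) x)%:E) \_ D) =
    ((fun x => (f x)%:E) \_ D) \o phi.
  by apply/funext => x; rewrite /patch /= -{1}DE; congr (if _ then _ else _).
rewrite [LHS]integralE [RHS]integralE.
set F := (_ \_ D).
rewrite funepos_comp funeneg_comp.
by congr (_ - _)%E; apply: ge0 => x; rewrite ?funepos_ge0 ?funeneg_ge0.
Qed.

End InvariantIntegral.

(** * Left invariance of the Haar integral *)

Section HaarInvariance.
Import Num.Def.
Local Open Scope sesquilinear_scope.
Import numFieldNormedType.Exports.
Local Open Scope classical_set_scope.
Local Open Scope complex_scope.
Variables (R : realType) (d : nat).

Lemma mulmx_continuous (W : 'M[R[i]]_d) :
  continuous ((fun V => W *m V) : 'M[R[i]^o]_d -> 'M[R[i]^o]_d).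
Proof.
move=> V A [P PV PA].
have FV : Filter (nbhs V) by apply: nbhs_filter.
suff H : \forall N \near V, forall ij : 'I_d * 'I_d, P ij.1 ij.2 ((W *m N) ij.1 ij.2).
  by apply: filterS H => N PN; apply: PA => i j; exact: (PN (i, j)).
apply: (@filter_forall _ _
  (fun ij => [set N : 'M[R[i]^o]_d | P ij.1 ij.2 ((W *m N) ij.1 ij.2)]) _ FV)
  => -[i j] /=.
  have : (fun N : 'M[R[i]^o]_d => (W *m N) i j : R[i]^o) @ V -->
      ((W *m V) i j : R[i]^o).
    rewrite mxE; under eq_fun do rewrite mxE.
    apply: cvg_big => [|k _]; first exact: add_continuous.
    by apply: (@cvgZl_tmp _ R[i]^o); exact: coord_continuous.
  by apply; exact: PV.
Qed.

Lemma measurable_mulmx (W : 'M[R[i]]_d) :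
  measurable_fun setT ((fun V => W *m V) : borel_mx R d -> borel_mx R d).
Proof.
apply: (@measurability _ _ (borel_mx R d) (borel_mx R d) _ _ (@open 'M[R[i]^o]_d)) => //.
move=> _ [A oA <-]; rewrite setTI; apply: sub_sigma_algebra.
by move/continuousP: (@mulmx_continuous W); apply.
Qed.

(** Multiplication by [W] preserves the measure and the unitary group, and is inverted by
    multiplication by the adjoint of [W]. *)
Lemma haar_integral_mulmx (mu : probability (borel_mx R d) R)
    (W : 'M[R[i]]_d) (f : 'M[R[i]]_d -> R[i]) :
  is_haar mu -> W \is unitarymx ->
  haar_integral mu (fun V => f (W *m V)) = haar_integral mu f.
Proof.
move=> [_ inv] uW.
have Wt : W *m W ^t* = 1%:M by exact/unitarymxP.
have preserving (X : 'M[R[i]]_d) : X \is unitarymx ->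
    measure_preserving mu (fun V : borel_mx R d => X *m V).
  by move=> uX; split; [exact: measurable_mulmx | exact: inv].
have uW' : W ^t* \is unitarymx by rewrite trmxC_unitary.
have uWE (V : 'M[R[i]]_d) : (W *m V \is unitarymx) = (V \is unitarymx).
  apply/idP/idP => [WVu|]; last exact: (mul_unitarymx uW).
  rewrite -[V]mul1mx -(mulmx1C Wt) -mulmxA.
  exact: mul_unitarymx uW' WVu.
have unitE : (fun V : borel_mx R d => W *m V) @^-1` @unitary_group R d
    = @unitary_group R d.
  by apply/funext => V; exact: (congr1 is_true (uWE V)).
have K : cancel (fun V : borel_mx R d => W ^t* *m V) (fun V => W *m V).
  by move=> V; rewrite mulmxA Wt mul1mx.
rewrite /haar_integral.
by congr Complex;
   exact: (Rintegral_comp_invariant _ (preserving _ uW) (preserving _ uW') K unitE).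
Qed.

End HaarInvariance.

(** * Balanced polynomials and averages over designs *)

Section DesignAverages.
Import Num.Def.
Local Open Scope sesquilinear_scope.
Local Open Scope complex_scope.
(* The notations of mpoly clash with those of mathcomp-analysis. *)
Import -(notations) mpoly.
Variables (R : realType) (d : nat).
Notation upoly := (mpoly.mpoly (d * d + d * d) R[i]).
Notation multinom := (mpoly.multinom (d * d + d * d)).

Definition deg_U (m : multinom) : nat :=
  (\sum_(i < d * d) fun_of_multinom m (lshift _ i))%N.
Definition deg_Uconj (m : multinom) : nat :=
  (\sum_(i < d * d) fun_of_multinom m (rshift _ i))%N.

Lemma balancedE t (p : upoly) : balanced t p <->
  forall m, mcoeff m p != 0 -> deg_U m = deg_Uconj m /\ (deg_U m <= t)%N.
Proof. by []. Qed.

Lemma balanced_sum t (I : finType) (F : I -> upoly) :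
  (forall i, balanced t (F i)) -> balanced t (\sum_i F i).
Proof.
move=> bF; apply/balancedE => m; rewrite raddf_sum /= => nz.
case: (boolP [exists i, mcoeff m (F i) != 0]) => [/existsP [j Fj]|].
  exact: (bF j).
move/existsPn => F0; case/negP: nz; apply/eqP/big1 => i _.
by apply/eqP; move: (F0 i); rewrite negbK.
Qed.

Lemma balanced_mul s t (p q : upoly) :
  balanced s p -> balanced t q -> balanced (s + t) (p * q).
Proof.
move=> /balancedE bp /balancedE bq; apply/balancedE => m.
rewrite -mcoeff_msupp => /msuppM_le /allpairsP[[m1 m2] /= [m1p m2q ->]].
rewrite !mcoeff_msupp in m1p m2q.
have [e1 l1] := bp _ m1p; have [e2 l2] := bq _ m2q.
have D1 : deg_U (mnm_add m1 m2) = (deg_U m1 + deg_U m2)%N.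
  by rewrite -big_split; apply: eq_bigr => i _; rewrite mnmDE.
have D2 : deg_Uconj (mnm_add m1 m2) = (deg_Uconj m1 + deg_Uconj m2)%N.
  by rewrite -big_split; apply: eq_bigr => i _; rewrite mnmDE.
by rewrite D1 D2 -e1 -e2; split=> //; exact: leq_add.
Qed.

(** Exponent of the monomial [U j k * conjC (U i l)]. *)
Definition entry_mnm (j k i l : 'I_d) : multinom :=
  mnm_add (mnm1 (lshift (d * d) (mxvec_index j k)))
    (mnm1 (rshift (d * d) (mxvec_index i l))).

Lemma deg_U_entry j k i l : deg_U (entry_mnm j k i l) = 1%N.
Proof.
rewrite /deg_U (bigD1 (mxvec_index j k)) //= big1 => [|m mjk].
  by rewrite mnmDE !mnm1E eqxx eq_rlshift.
by rewrite mnmDE !mnm1E eq_lshift eq_sym (negPf mjk) eq_rlshift.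
Qed.

Lemma deg_Uconj_entry j k i l : deg_Uconj (entry_mnm j k i l) = 1%N.
Proof.
rewrite /deg_Uconj (bigD1 (mxvec_index i l)) //= big1 => [|m mil].
  by rewrite mnmDE !mnm1E eqxx eq_lrshift.
by rewrite mnmDE !mnm1E eq_rshift [_ == m]eq_sym (negPf mil) eq_lrshift.
Qed.

(** The function sending [V] to the trace of [X V A V^t*], expanded in the entries of [V] and their
    conjugates. *)
Definition trace_poly (X A : 'M[R[i]]_d) : upoly :=
  \sum_i \sum_j \sum_k \sum_l (X i j * A k l) *: mpolyX _ (entry_mnm j k i l).

Lemma balanced_trace_poly X A : balanced 1 (trace_poly X A).
Proof.
apply: balanced_sum => i; apply: balanced_sum => j.
apply: balanced_sum => k; apply: balanced_sum => l.
apply/balancedE => m; rewrite mcoeffZ mcoeffX.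
case: (eqVneq (entry_mnm j k i l) m) => [<- _|_]; last by rewrite mulr0 eqxx.
by rewrite deg_U_entry deg_Uconj_entry.
Qed.

Lemma ueval_entry (V : 'M[R[i]]_d) j k i l :
  ueval (mpolyX _ (entry_mnm j k i l)) V = V j k * conjC (V i l).
Proof.
rewrite /ueval /entry_mnm mpolyXD mevalM !mevalXU.
by rewrite row_mxEl row_mxEr !mxvecE mxE.
Qed.

Lemma ueval_trace_poly X A V :
  ueval (trace_poly X A) V = \tr (X *m (V *m A *m V ^t*)).
Proof.
rewrite /ueval /trace_poly raddf_sum; apply: eq_bigr => i _.
rewrite raddf_sum mxE; apply: eq_bigr => j _.
rewrite mxE mulr_sumr raddf_sum [LHS]/=.
under eq_bigr do rewrite raddf_sum.
rewrite exchange_big; apply: eq_bigr => l _.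
rewrite !mxE mulr_suml mulr_sumr; apply: eq_bigr => k _.
rewrite [LHS]mevalZ -/(ueval _ V) ueval_entry; ring.
Qed.

Variables (mu : probability (borel_mx R d) R) (B : finType).
Variable U : B -> 'M[R[i]]_d.
Hypothesis haar : is_haar mu.

(** Both averages are Haar integrals, one of [p] and one of its left translate by [W]. *)
Lemma design_sum_mulmx t (p q : upoly) (W : 'M[R[i]]_d) :
  unitary_design mu t U -> W \is unitarymx -> balanced t p -> balanced t q ->
  (forall V, ueval q V = ueval p (W *m V)) ->
  \sum_b ueval q (U b) = \sum_b ueval p (U b).
Proof.
move=> [_ desU] uW bp bq qp.
(* For an empty family both sums are empty; otherwise the factor [#|B|%:R^-1] can be cancelled. *)
have B0 : #|B|%:R != 0 :> R[i] \/ \sum_b ueval q (U b) = \sum_b ueval p (U b).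
  have [/card0_eq B0|] := posnP #|B|.
    by right; rewrite !big_pred0.
  by left; rewrite pnatr_eq0 -lt0n.
case: B0 => // B0.
apply: (mulfI (x := #|B|%:R^-1)); first by rewrite invr_eq0.
rewrite (desU _ bp) (desU _ bq) -(haar_integral_mulmx (ueval p) haar uW).
by congr haar_integral; apply/funext.
Qed.

(** As [A] is fixed, the trace polynomial of [Y] and [A] is constant on the family, equal to the
    trace of [Y A]. Translating by [W] thus shows that [A] and [W A W^t*] have the same pairing with
    every [X]. *)
Lemma design1_commutant_scalar (A : 'M[R[i]]_d) :
  unitary_design mu 1 U -> (0 < #|B|)%N ->
  (forall b, U b *m A *m (U b) ^t* = A) -> is_scalar_mx A.
Proof.
move=> desU B0 UA; apply: unitary_invariant_scalar => W uW.
have sumE Y : \sum_b ueval (trace_poly Y A) (U b) = \tr (Y *m A) *+ #|B|.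
  by under eq_bigr do rewrite ueval_trace_poly UA; rewrite sumr_const.
have trE X : \tr (X *m (W *m A *m W^t*)) = \tr (X *m A).
  have := design_sum_mulmx desU uW (@balanced_trace_poly X A)
    (@balanced_trace_poly (W^t* *m X *m W) A) _.
  rewrite !sumE => tr_eq.
  have {tr_eq} : \tr (W^t* *m X *m W *m A) *+ #|B| = \tr (X *m A) *+ #|B|.
    by apply: tr_eq => V; rewrite !ueval_trace_poly mxtrace_translate.
  move/(pmulrnI B0) => <-.
  have := mxtrace_translate W 1%:M A X.
  by rewrite mulmx1 mul1mx trmx1 map_mx1 mulmx1 => ->.
apply/matrixP => i j; move: (trE (delta_mx j i)).
by rewrite mxtrace_mulC mxtrace_mul_delta mxtrace_mulC mxtrace_mul_delta.
Qed.

(* The annihilator of the orbit of [A] under the design is invariant under all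
   unitaries: apply the design property to the polynomial
   [V |-> |tr (X V A V^* )|^2] and its translates. *)
Lemma design2_annihilator_scalar (A X : 'M[R[i]]_d) :
  unitary_design mu 2 U -> (0 < #|B|)%N -> ~~ is_scalar_mx A ->
  (forall b, \tr (X *m (U b *m A *m (U b) ^t*)) = 0) -> is_scalar_mx X.
Proof.
move=> desU /card_gt0P [b0 _] nsA XA.
pose p (Y : 'M[R[i]]_d) := trace_poly Y A * trace_poly (Y ^t*) (A ^t*).
have bp Y : balanced 2 (p Y).
  by apply: (@balanced_mul 1 1); exact: balanced_trace_poly.
have pE Y V : ueval (p Y) V = `| \tr (Y *m (V *m A *m V ^t*)) | ^+ 2.
  rewrite {1}/ueval mevalM -!/(ueval _ V) !ueval_trace_poly.
  by rewrite mxtrace_conjC_pairing normCK.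
(* The sum of squares over the translated family vanishes, hence so does each term; the term at [b0]
   is this trace. The orbit point at [b0] replaces [A], to which it is unitarily conjugate. *)
have XWA W : W \is unitarymx ->
    \tr (X *m (W *m (U b0 *m A *m (U b0) ^t*) *m W ^t*)) = 0.
  move=> uW.
  have sum0 : \sum_b `|\tr (X *m ((W *m U b) *m A *m (W *m U b)^t*))| ^+ 2 = 0.
    transitivity (\sum_b ueval (p (W^t* *m X *m W)) (U b)).
      by apply: eq_bigr => b _; rewrite pE mxtrace_translate.
    rewrite (design_sum_mulmx desU uW (bp X) (bp _)) => [|V].
      by apply: big1 => b _; rewrite pE XA normr0 expr0n.
    by rewrite !pE mxtrace_translate.
  by rewrite -(sum_normr_sqr_eq0 sum0 b0) conjC_trmx_mul !mulmxA.
have uU : U b0 \is unitarymx by case: desU.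
have [sUA|//] := not_scalar_pairing XWA.
by case/negP: nsA; exact: scalar_unitary_conj uU sUA.
Qed.

End DesignAverages.

(** * The natural representation *)

(** Row form of [ketket], since MathComp modules consist of rows; locked to hide the double sum of
    tensors. *)
HB.lock Definition vec (C : numClosedFieldType) (n : nat) (A : 'M[C]_n) :
  'rV[C]_(n * n) := (ketket A)^T.

Arguments vec {C n} A.

Section Vectorization.
Variables (C : numClosedFieldType) (n : nat).
Implicit Types A X Y : 'M[C]_n.

Definition unvec (v : 'rV[C]_(n * n)) : 'M[C]_n :=
  \matrix_(k, l) v 0 (mxtens_index (k, l)).

Lemma vecE A k l : vec A 0 (mxtens_index (k, l)) = A k l.
Proof.
rewrite vec.unlock mxE summxE (bigD1 k) //= summxE (bigD1 l) //=.
have entry i j : (delta_mx i 0 *t delta_mx j 0 : 'M[C]_(n * n, 1 * 1))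
    (mxtens_index (k, l)) 0 = ((k == i) && (l == j))%:R.
  have -> : (0 : 'I_(1 * 1)) = mxtens_index (0, 0) by apply: val_inj.
  by rewrite tensmxE !mxE !andbT -natrM mulnb.
rewrite mxE entry !eqxx mulr1 big1 => [|j jl]; last first.
  by rewrite mxE entry [l == j]eq_sym (negPf jl) andbF mulr0.
rewrite addr0 big1 ?addr0 // => i ik; rewrite summxE big1 // => j _.
by rewrite mxE entry [k == i]eq_sym (negPf ik) mulr0.
Qed.

Lemma vecK : cancel vec unvec.
Proof. by move=> A; apply/matrixP => k l; rewrite mxE vecE. Qed.

Lemma unvecK : cancel unvec vec.
Proof.
move=> v; apply/rowP => m; case: (mxtens_indexP m) => k l.
by rewrite vecE mxE.
Qed.

Lemma vec_linear a A Y : vec (a *: A + Y) = a *: vec A + vec Y.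
Proof.
by apply: (can_inj unvecK); rewrite vecK; apply/matrixP => k l; rewrite !mxE !vecE.
Qed.

Lemma vec0 : vec (0 : 'M[C]_n) = 0.
Proof. by apply: (can_inj unvecK); rewrite vecK; apply/matrixP => k l; rewrite !mxE. Qed.

Lemma big_mxtens_index (F : 'I_(n * n) -> C) :
  \sum_m F m = \sum_i \sum_j F (mxtens_index (i, j)).
Proof.
rewrite pair_bigA /= (reindex (@mxtens_index n n)) /=; last first.
  by exists (@mxtens_unindex n n) => x _; rewrite ?mxtens_indexK ?mxtens_unindexK.
by apply: eq_bigr => -[i j].
Qed.

(** This turns tensor products acting on vectors into two-sided multiplication, so that
    [natural_repr] acts by conjugation. *)
Lemma vec_tens A X Y : vec A *m (X *t Y)^T = vec (X *m A *m Y^T).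
Proof.
apply/rowP => m; case: (mxtens_indexP m) => k l.
rewrite vecE mxE big_mxtens_index exchange_big [RHS]mxE; apply: eq_bigr => j _.
rewrite [in RHS]mxE mulr_suml; apply: eq_bigr => i _.
by rewrite vecE mxE tensmxE [Y^T j l]mxE; ring.
Qed.

Lemma vec_dot A Y : (vec A *m (vec Y)^T) 0 0 = \tr (A *m Y^T).
Proof.
rewrite mxE big_mxtens_index; apply: eq_bigr => i _; rewrite mxE.
by apply: eq_bigr => j _; rewrite [in LHS]mxE !vecE [Y^T j i]mxE.
Qed.

Lemma map_vec (f : {rmorphism C -> C}) A : map_mx f (vec A) = vec (map_mx f A).
Proof.
by apply/rowP => m; case: (mxtens_indexP m) => k l; rewrite mxE !vecE mxE.
Qed.

End Vectorization.

Section NaturalAction.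
Import Num.Def.
Local Open Scope sesquilinear_scope.
Variables (C : numClosedFieldType) (gT : finGroupType) (G : {group gT}).
Variables (n : nat) (rG : mx_representation C G n).

Lemma vec_natural (A : 'M[C]_n) g :
  vec A *m colmod_repr (natural_repr rG) g =
  vec (rG g^-1%g *m A *m (rG g^-1%g) ^t*).
Proof. by rewrite /= /colmod_mx /= /natural_mx vec_tens map_trmx. Qed.

End NaturalAction.

(** * Matrices supported on one block, and their traceless part *)

Section CornerTraceless.
Import Num.Def.
Local Open Scope sesquilinear_scope.
Variables (C : numClosedFieldType) (n d : nat) (J : 'M[C]_(n, d)).
Hypothesis J_isometry : J^T *m J = 1%:M.
Hypothesis J_real : map_mx conjC J = J.

(** The orthogonal projector onto the range of [J]. *)
Let e := J *m J^T.

Definition corner_mx : 'M[C]_(n * n) := (e *t e)^T.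
(** Orthogonality to [vec e] means trace zero inside the corner. *)
Definition traceless_mx : 'M[C]_(n * n) :=
  (corner_mx :&: orthomx conjC 1%:M (vec e))%MS.

Lemma corner_idem : e *m e = e.
Proof. by rewrite /e mulmxA -[J *m J^T *m J]mulmxA J_isometry mulmx1. Qed.

Lemma corner_tr : e^T = e.
Proof. by rewrite /e trmx_mul trmxK. Qed.

Lemma vec_corner_mx A : vec A *m corner_mx = vec (e *m A *m e).
Proof. by rewrite vec_tens corner_tr. Qed.

Lemma vec_sub_corner A : (vec A <= corner_mx)%MS = (e *m A *m e == A).
Proof.
apply/idP/eqP => [/submxP[u Eu]|<-]; last by rewrite -vec_corner_mx submxMl.
apply: (can_inj (@vecK C n)).
rewrite -vec_corner_mx Eu -(unvecK u) !vec_corner_mx.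
move: corner_idem; move: e => f ff.
by rewrite !mulmxA ff -!mulmxA ff.
Qed.

Lemma sub_cornerP A :
  reflect (exists A0, A = J *m A0 *m J^T) (vec A <= corner_mx)%MS.
Proof.
rewrite vec_sub_corner; apply: (iffP eqP) => [<-|[A0 ->]].
  by exists (J^T *m A *m J); rewrite /e !mulmxA.
by rewrite /e !mulmxA -[J *m J^T *m J]mulmxA J_isometry mulmx1
           -[_ *m J^T *m J]mulmxA J_isometry mulmx1.
Qed.

Lemma mxtrace_corner (A0 : 'M[C]_d) : \tr (J *m A0 *m J^T) = \tr A0.
Proof. by rewrite mxtrace_mulC mulmxA J_isometry mul1mx. Qed.

Lemma vec_sub_ortho A :
  (vec A <= orthomx conjC 1%:M (vec e))%MS = (\tr (A *m e) == 0).
Proof.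
rewrite /orthomx mul1mx (sameP sub_kermxP eqP) -map_trmx map_vec.
have -> : map_mx conjC e = e by rewrite /e map_mxM -map_trmx J_real.
rewrite -{2}corner_tr -vec_dot; apply/eqP/eqP => [->|E]; first by rewrite mxE.
by apply/matrixP => i j; rewrite !ord1 E mxE.
Qed.

Lemma sub_tracelessP A :
  reflect (exists2 A0, A = J *m A0 *m J^T & \tr A0 = 0) (vec A <= traceless_mx)%MS.
Proof.
rewrite sub_capmx vec_sub_ortho; apply: (iffP andP).
  move=> [/sub_cornerP[A0 ->]]; rewrite /e mulmxA -[_ *m J^T *m J]mulmxA.
  by rewrite J_isometry mulmx1 mxtrace_corner => /eqP; exists A0.
move=> [A0 EA trA]; split; first by apply/sub_cornerP; exists A0.
by rewrite EA /e mulmxA -[_ *m J^T *m J]mulmxA J_isometry mulmx1 mxtrace_corner trA.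
Qed.

(** The corner projector is [K *m K^T] for the isometry [K = J *t J], so its rank is the number of
    columns of [K]. *)
Lemma rank_corner_mx : \rank corner_mx = (d * d)%N.
Proof.
pose K : 'M[C]_(n * n, d * d) := J *t J.
have KK : K^T *m K = 1%:M.
  rewrite trmx_tens tensmx_mul J_isometry.
  apply/matrixP => i j; case: (mxtens_indexP i) (mxtens_indexP j) => i1 i2 [j1 j2].
  rewrite tensmxE !mxE (can_eq (@mxtens_indexK _ _)) xpair_eqE.
  by rewrite -natrM mulnb.
have PK : corner_mx = K *m K^T.
  by rewrite /corner_mx /K trmx_tens corner_tr trmx_tens tensmx_mul.
apply/eqP; rewrite eqn_leq PK (leq_trans (mxrankM_maxl _ _) (rank_leq_col _)) /=.
have {1}<- : \rank (K^T *m (K *m K^T) *m K) = (d * d)%N.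
  by rewrite mulmxA KK mul1mx KK mxrank1.
exact: leq_trans (mxrankM_maxl _ _) (mxrankM_maxr _ _).
Qed.

(** A single linear equation lowers the rank by at most one. *)
Lemma rank_cap_ortho_ge (W : 'M[C]_(n * n)) :
  (\rank W <= (\rank (W :&: orthomx conjC 1%:M (vec e))%MS).+1)%N.
Proof.
rewrite /orthomx mul1mx -(mxrank_mul_ker W ((vec e)^t*)).
by rewrite -[X in (_ <= X)%N]add1n leq_add2r rank_leq_col.
Qed.

(** The rank drops by exactly one: [e] lies in the corner and has trace [d], so it violates the
    trace equation. *)
Lemma rank_traceless_mx : (0 < d)%N -> \rank traceless_mx = (d * d).-1.
Proof.
move=> d0; rewrite -rank_corner_mx /traceless_mx /orthomx mul1mx.
rewrite -(mxrank_mul_ker corner_mx ((vec e)^t*)).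
suff -> : \rank (corner_mx *m (vec e)^t*) = 1%N by [].
apply/eqP; rewrite eqn_leq rank_leq_col lt0n mxrank_eq0.
apply/eqP => P0.
have : (vec e *m corner_mx *m (vec e)^t*) 0 0 = 0 by rewrite -mulmxA P0 mulmx0 mxE.
rewrite vec_corner_mx !corner_idem -map_trmx map_vec.
have -> : map_mx conjC e = e by rewrite /e map_mxM -map_trmx J_real.
rewrite vec_dot corner_tr corner_idem /e mxtrace_mulC J_isometry mxtrace1.
by move/eqP; rewrite pnatr_eq0 -leqn0 leqNgt d0.
Qed.

End CornerTraceless.

(** * Fixed lines, and isotypic components of multiplicity one *)

Section FixedLines.
Variables (F : fieldType) (gT : finGroupType) (G : {group gT}) (n : nat).
Variable rG : mx_representation F G n.

Lemma trivial_simple_line (v : 'rV[F]_n) :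
  v != 0 -> (v <= rfix_mx rG G)%MS -> trivial_simple rG <<v>>%MS.
Proof.
move=> nzv fixv; split; last by rewrite genmxE.
split=> [||U modU sUv nzU]; last 1 first.
- have [_] := mxrank_leqif_sup sUv; rewrite genmxE => <-.
  rewrite eqn_leq mxrankS //; last by rewrite genmxE in sUv.
  by rewrite rank_rV nzv lt0n mxrank_eq0.
- apply/mxmoduleP => g Gg; rewrite (eqmxMr _ (genmxE _)) genmxE.
  by rewrite (rfix_mxP G fixv g Gg).
- by rewrite -mxrank_eq0 genmxE mxrank_eq0.
Qed.

Lemma mx_iso_rfix (U V : 'M[F]_n) (H : {set gT}) : H \subset G ->
  mx_iso rG U V -> (U <= rfix_mx rG H)%MS -> (V <= rfix_mx rG H)%MS.
Proof.
move=> sHG [f _ homf defV] /rfix_mxP fixU; rewrite -defV.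
apply/rfix_mxP => g Hg.
by rewrite -(hom_mxP homf) ?fixU // (fintype.subsetP sHG).
Qed.

End FixedLines.

Lemma multiplicity_component_eq (F : decFieldType) (gT : finGroupType)
    (G : {group gT}) (n : nat) (rG : mx_representation F G n) (W : 'M[F]_n)
    (simW : mxsimple rG W) :
  (component_mx rG W <= W)%MS -> multiplicity simW = 1%N.
Proof.
move=> compW; rewrite /multiplicity /socle_mult.
set P := PackSocle _.
have PE : (P : 'M[F]_n) = component_mx rG W by rewrite PackSocleK.
(* The constituent used in the definition of the multiplicity is an arbitrary one, only isomorphic
   to [W]; equality of ranks is enough. *)
have isoP : mx_iso rG W (socle_base P).
  apply: component_mx_iso => //; first exact: socle_simple.
  by rewrite -PE; exact: component_mx_id (socle_simple P).
have -> : \rank (P : 'M[F]_n) = \rank W.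
  by rewrite PE; apply/eqP; rewrite eqn_leq !mxrankS // component_mx_id.
rewrite -(mxrank_iso isoP) divnn lt0n mxrank_eq0.
by have [_ -> _] := simW.
Qed.

(** * Irreducibility of the traceless part of a corner on which the group acts through a family
    [U] *)

Section CornerModule.
Import Num.Def.
Local Open Scope sesquilinear_scope.
Variables (C : numClosedFieldType) (gT : finGroupType) (G : {group gT}).
Variables (n d : nat) (rG : mx_representation C G n) (J : 'M[C]_(n, d)).
Hypothesis J_isometry : J^T *m J = 1%:M.
Hypothesis J_real : map_mx conjC J = J.

Notation nat_rep := (colmod_repr (natural_repr rG)).

Lemma J_conjC_trmx : J ^t* = J^T.
Proof. by rewrite -map_trmx J_real. Qed.

(** The phase [c], which is the sign on the second block, cancels against its conjugate. *)
Lemma conj_corner (X : 'M[C]_n) (V : 'M[C]_d) (c : C) (A0 : 'M[C]_d) :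
  c * c^* = 1 -> X *m J = J *m (c *: V) ->
  X *m (J *m A0 *m J^T) *m X ^t* = J *m (V *m A0 *m V ^t*) *m J^T.
Proof.
move=> cc XJ.
have -> : X *m (J *m A0 *m J^T) *m X^t* = (X *m J) *m A0 *m (X *m J)^t*.
  by rewrite conjC_trmx_mul J_conjC_trmx !mulmxA.
rewrite XJ conjC_trmx_mul J_conjC_trmx [(c *: V)^T]linearZ /= map_mxZ.
by rewrite -scalemxAr -!scalemxAl -scalemxAr scalerA cc scale1r !mulmxA.
Qed.

Lemma corner_mx_hom (W : 'M[C]_(n * n)) :
  (forall g, g \in G -> rG g *m (J *m J^T) = (J *m J^T) *m rG g) ->
  (W <= dom_hom_mx nat_rep (corner_mx J))%MS.
Proof.
move=> comm; apply/hom_mxP => g Gg; apply/row_matrixP => i; rewrite !row_mul.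
rewrite -(unvecK (row i W)) vec_corner_mx // !vec_natural vec_corner_mx //.
have cg := comm _ (groupVr Gg).
have e_adj : (J *m J^T) ^t* = J *m J^T.
  by rewrite conjC_trmx_mul trmxK J_real J_conjC_trmx.
(* The projector is self-adjoint, so it also commutes with the adjoint. *)
have cg' : (rG g^-1%g) ^t* *m (J *m J^T) = (J *m J^T) *m (rG g^-1%g) ^t*.
  by rewrite -[X in _ *m X = _]e_adj -conjC_trmx_mul -cg conjC_trmx_mul e_adj.
move: (J *m J^T) cg cg' => e cg cg'.
by rewrite !mulmxA -cg -!mulmxA cg'.
Qed.

Variables (B : finType) (U : B -> 'M[C]_d).
Hypothesis U_unitary : forall b, U b \is unitarymx.
Hypothesis act_in_U : forall g, g \in G -> exists b, forall A0 : 'M[C]_d,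
  rG g^-1%g *m (J *m A0 *m J^T) *m (rG g^-1%g) ^t* =
  J *m (U b *m A0 *m (U b) ^t*) *m J^T.
Hypothesis U_in_act : forall b, exists2 g, g \in G & forall A0 : 'M[C]_d,
  rG g^-1%g *m (J *m A0 *m J^T) *m (rG g^-1%g) ^t* =
  J *m (U b *m A0 *m (U b) ^t*) *m J^T.
Hypothesis orbit_annihilator_scalar : forall A X : 'M[C]_d, ~~ is_scalar_mx A ->
  (forall b, \tr (X *m (U b *m A *m (U b) ^t*)) = 0) -> is_scalar_mx X.

Lemma traceless_module : mxmodule nat_rep (traceless_mx J).
Proof.
apply/mxmoduleP => g Gg; apply/row_subP => i; rewrite row_mul.
have : (row i (traceless_mx J) <= traceless_mx J)%MS by rewrite row_sub.
rewrite -(unvecK (row i _)) => /sub_tracelessP[]// A0 -> trA0.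
have [b bE] := act_in_U Gg; rewrite vec_natural bE; apply/sub_tracelessP => //.
exists (U b *m A0 *m (U b)^t*) => //.
by rewrite mxtrace_mulC mulmxA unitarymx_adj // mul1mx.
Qed.

(** By duality: each column of [cokermx W], read as a matrix, annihilates the orbit of a nonzero
    traceless element of [W]. Its compression to the corner is then scalar, so it annihilates every
    traceless matrix. *)
Lemma traceless_sub_module (W : 'M[C]_(n * n)) :
  mxmodule nat_rep W -> (W <= traceless_mx J)%MS -> W != 0 ->
  (traceless_mx J <= W)%MS.
Proof.
move=> modW sWT nzW.
have := submx_trans (nz_row_sub W) sWT; move: (nz_row_sub W) (nzW).
rewrite -nz_row_eq0 -(unvecK (nz_row W)) => sAW nzA.
case/sub_tracelessP => // A0 EA trA0.
(* A scalar matrix of trace zero vanishes: either its size or its scalar is 0. *)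
have nsA0 : ~~ is_scalar_mx A0.
  apply/negP => /is_scalar_mxP[a Ea]; case/negP: nzA.
  rewrite EA Ea; move: trA0; rewrite Ea mxtrace_scalar.
  move/eqP; rewrite mulrn_eq0 => /orP[/eqP d0|/eqP ->].
    have -> : a%:M = 0 :> 'M[C]_d.
      by apply/matrixP => i j; have := ltn_ord i; rewrite {2}d0.
    by rewrite mulmx0 mul0mx vec0.
  by rewrite raddf0 mulmx0 mul0mx vec0.
apply/rV_subP => u; rewrite -(unvecK u) => /sub_tracelessP[]// Z0 -> trZ0.
rewrite submxE; apply/eqP/rowP => j; rewrite [RHS]mxE.
have mul_col (v : 'rV[C]_(n * n)) (K : 'M[C]_(n * n)) :
    (v *m K) 0 j = (v *m col j K) 0 0 by rewrite colE mulmxA -colE [RHS]mxE.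
rewrite mul_col.
pose X := unvec (col j (cokermx W))^T.
have colX : col j (cokermx W) = (vec X)^T by rewrite unvecK trmxK.
have trX A : (vec A <= W)%MS -> \tr (A *m X^T) = 0.
  by rewrite submxE -vec_dot -colX -mul_col => /eqP ->; rewrite mxE.
have pairing Y : \tr (J *m Y *m J^T *m X^T) = \tr ((J^T *m X^T *m J) *m Y).
  by rewrite -!mulmxA mxtrace_mulC -!mulmxA mxtrace_mulC -!mulmxA.
have /is_scalar_mxP[x Ex] : is_scalar_mx (J^T *m X^T *m J).
  apply: (orbit_annihilator_scalar nsA0) => b; rewrite -pairing; apply: trX.
  have [g Gg gE] := U_in_act b; rewrite -gE -EA -vec_natural.
  exact: mxmodule_trans.
by rewrite colX vec_dot pairing Ex mul_scalar_mx mxtraceZ trZ0 mulr0.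
Qed.

Lemma traceless_simple : (1 < d)%N -> mxsimple nat_rep (traceless_mx J).
Proof.
move=> d1; split; [exact: traceless_module | | exact: traceless_sub_module].
have d0 : (0 < d)%N := ltnW d1.
rewrite -mxrank_eq0 (rank_traceless_mx J_isometry J_real d0).
rewrite -lt0n -subn1 subn_gt0.
exact: leq_trans d1 (leq_pmulr d d0).
Qed.

End CornerModule.

(** * The direct sum of two blocks with a relative sign *)

Section TwoBlocks.
Import Num.Def.
Local Open Scope sesquilinear_scope.
Variables (C : numClosedFieldType) (d1 d2 : nat).

Definition incl1 : 'M[C]_(d1 + d2, d1) := col_mx 1%:M 0.
Definition incl2 : 'M[C]_(d1 + d2, d2) := col_mx 0 1%:M.
Let e1 := incl1 *m incl1^T.
Let e2 := incl2 *m incl2^T.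

Lemma incl1_isometry : incl1^T *m incl1 = 1%:M.
Proof. by rewrite /incl1 tr_col_mx mul_row_col trmx1 trmx0 mulmx1 mulmx0 addr0. Qed.

Lemma incl2_isometry : incl2^T *m incl2 = 1%:M.
Proof. by rewrite /incl2 tr_col_mx mul_row_col trmx1 trmx0 mulmx1 mulmx0 add0r. Qed.

Lemma incl1_real : map_mx conjC incl1 = incl1.
Proof. by rewrite /incl1 map_col_mx map_mx1 map_mx0. Qed.

Lemma incl2_real : map_mx conjC incl2 = incl2.
Proof. by rewrite /incl2 map_col_mx map_mx1 map_mx0. Qed.

Lemma incl1_corner : e1 = block_mx 1%:M 0 0 0.
Proof.
by rewrite /e1 /incl1 tr_col_mx mul_col_row trmx1 trmx0
           !(mul1mx, mul0mx, mulmx0, mulmx1, addr0, add0r).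
Qed.

Lemma incl2_corner : e2 = block_mx 0 0 0 1%:M.
Proof.
by rewrite /e2 /incl2 tr_col_mx mul_col_row trmx1 trmx0
           !(mul1mx, mul0mx, mulmx0, mulmx1, addr0, add0r).
Qed.

Lemma corner_block1 (M : 'M[C]_d1) : incl1 *m M *m incl1^T = block_mx M 0 0 0.
Proof.
by rewrite /incl1 tr_col_mx mul_col_mx mul_col_row trmx1 trmx0
           !(mul1mx, mul0mx, mulmx0, mulmx1, addr0, add0r).
Qed.

Definition block_sign : 'M[C]_(d1 + d2) := block_mx 1%:M 0 0 (- 1%:M).

Lemma block_sign_conj (A : 'M[C]_(d1 + d2)) :
  block_sign *m A *m block_sign ^t* =
  block_mx (ulsubmx A) (- ursubmx A) (- dlsubmx A) (drsubmx A).
Proof.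
have N1 : (- 1%:M : 'M[C]_d2) ^t* = - 1%:M.
  by apply/matrixP => i j; rewrite !mxE rmorphN rmorph_nat eq_sym.
rewrite -{1}(submxK A) /block_sign tr_block_mx map_block_mx N1 !trmx0 !map_mx0.
rewrite trmx1 map_mx1 !mulmx_block.
by rewrite !(mul1mx, mul0mx, mulmx0, mulmx1, addr0, add0r, mulmxN, mulNmx, opprK, oppr0).
Qed.

Lemma block_sign_fixed (A : 'M[C]_(d1 + d2)) :
  block_sign *m A *m block_sign ^t* = A ->
  A = block_mx (ulsubmx A) 0 0 (drsubmx A).
Proof.
rewrite block_sign_conj => E.
have neg0 m p (M : 'M[C]_(m, p)) : - M = M -> M = 0.
  move=> /matrixP MN; apply/matrixP => i j; move: (MN i j); rewrite !mxE.
  by move/eqP; rewrite eqNr => /eqP.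
have := E; rewrite -{5}(submxK A) => /eq_block_mx[_ /neg0 u0 /neg0 l0 _].
by rewrite -{1}(submxK A) u0 l0.
Qed.

Variables (B : finType) (U1 : B -> 'M[C]_d1) (U2 : B -> 'M[C]_d2).
Hypothesis U1_unitary : forall b, U1 b \is unitarymx.
Hypothesis U2_unitary : forall b, U2 b \is unitarymx.

(** [block_unitary] over a general [numClosedFieldType]; the two are convertible over [R[i]]. *)
Definition signed_block (x : B * bool) : 'M[C]_(d1 + d2) :=
  block_mx (U1 x.1) 0 0 ((-1) ^+ x.2 *: U2 x.1).

Lemma sign_mul_conjC (s : bool) : (-1) ^+ s * ((-1) ^+ s)^* = 1 :> C.
Proof. by rewrite rmorph_sign -signr_addb addbb. Qed.

Lemma signed_block_conj1 x (A0 : 'M[C]_d1) :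
  signed_block x *m (incl1 *m A0 *m incl1^T) *m (signed_block x) ^t* =
  incl1 *m (U1 x.1 *m A0 *m (U1 x.1) ^t*) *m incl1^T.
Proof.
apply: (@conj_corner _ _ _ _ incl1_real _ _ 1); first by rewrite rmorph1 mulr1.
by rewrite scale1r /incl1 mul_block_col mul_col_mx 
           !(mul1mx, mul0mx, mulmx0, mulmx1, addr0, add0r).
Qed.

Lemma signed_block_conj2 x (A0 : 'M[C]_d2) :
  signed_block x *m (incl2 *m A0 *m incl2^T) *m (signed_block x) ^t* =
  incl2 *m (U2 x.1 *m A0 *m (U2 x.1) ^t*) *m incl2^T.
Proof.
apply: (@conj_corner _ _ _ _ incl2_real _ _ ((-1) ^+ x.2)).
  exact: sign_mul_conjC.
by rewrite /incl2 mul_block_col mul_col_mx 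
           !(mul1mx, mul0mx, mulmx0, mulmx1, addr0, add0r).
Qed.

Lemma signed_block_comm2 x : signed_block x *m e2 = e2 *m signed_block x.
Proof.
by rewrite incl2_corner /signed_block !mulmx_block
           !(mul1mx, mul0mx, mulmx0, mulmx1, addr0, add0r).
Qed.

Variables (gT : finGroupType) (G : {group gT}).
Variable rG : mx_representation C G (d1 + d2).
Hypothesis rG_image : forall M : 'M[C]_(d1 + d2),
  (exists2 g, g \in G & rG g = M) <-> (exists x, signed_block x = M).

Notation nat_rep := (colmod_repr (natural_repr rG)).
Let line1 := <<vec e1>>%MS.
Let line2 := <<vec e2>>%MS.

Lemma rG_inv_block g : g \in G -> exists x, rG g^-1%g = signed_block x.
Proof.
move=> Gg; have [x <-] : exists x, signed_block x = rG g^-1%g.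
  by apply/rG_image; exists g^-1%g; rewrite ?groupV.
by exists x.
Qed.

Lemma rG_block x : exists2 g, g \in G & rG g^-1%g = signed_block x.
Proof.
have [g Gg <-] : exists2 g, g \in G & rG g = signed_block x.
  by apply/rG_image; exists x.
by exists g^-1%g; rewrite ?groupV ?invgK.
Qed.

(** The identity is one of the signed blocks; flipping its sign index gives [block_sign]. *)
Lemma rG_block_sign : exists2 g, g \in G & rG g^-1%g = block_sign.
Proof.
have [[b s]] : exists x, signed_block x = 1%:M.
  by apply/rG_image; exists 1%g; rewrite ?repr_mx1.
rewrite /signed_block /= scalar_mx_block => /eq_block_mx[U1b _ _ U2b].
have [g Gg gE] := rG_block (b, ~~ s); exists g => //.
rewrite gE /signed_block /block_sign /= U1b; congr block_mx.
by rewrite signrN scaleNr U2b.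
Qed.

Lemma U_index_gt0 : (0 < #|B|)%N.
Proof.
have [[b _] _] : exists x, signed_block x = 1%:M.
  by apply/rG_image; exists 1%g; rewrite ?repr_mx1.
by apply/card_gt0P; exists b.
Qed.

Lemma vec_fixedP A : reflect
  (forall x, signed_block x *m A *m (signed_block x) ^t* = A)
  (vec A <= rfix_mx nat_rep G)%MS.
Proof.
apply: (iffP (rfix_mxP G)) => fixA.
  move=> x; have [g Gg gE] := rG_block x.
  apply: (can_inj (@vecK C _)); rewrite -[RHS](fixA g Gg).
  by rewrite vec_natural gE.
by move=> g Gg; have [x xE] := rG_inv_block Gg; rewrite vec_natural xE fixA.
Qed.

Lemma line1_fixed : (vec e1 <= rfix_mx nat_rep G)%MS.
Proof.
apply/vec_fixedP => x; rewrite /e1.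
have := signed_block_conj1 x 1%:M; rewrite mulmx1 => ->.
by rewrite mulmx1 (unitarymxP _) // mulmx1.
Qed.

Lemma line2_fixed : (vec e2 <= rfix_mx nat_rep G)%MS.
Proof.
apply/vec_fixedP => x; rewrite /e2.
have := signed_block_conj2 x 1%:M; rewrite mulmx1 => ->.
by rewrite mulmx1 (unitarymxP _) // mulmx1.
Qed.

Lemma vec_corner_neq0 n d (J : 'M[C]_(n, d)) : (0 < d)%N ->
  J^T *m J = 1%:M -> vec (J *m J^T) != 0.
Proof.
move=> d0 JJ; apply: contraTneq d0 => /(congr1 (@unvec C n)).
rewrite vecK -vec0 vecK => /(congr1 mxtrace).
by rewrite mxtrace_mulC JJ mxtrace1 mxtrace0 => /eqP; rewrite pnatr_eq0 => /eqP ->.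
Qed.

Hypotheses (d1_gt0 : (0 < d1)%N) (d2_gt0 : (0 < d2)%N).

Lemma line1_trivial_simple : trivial_simple nat_rep line1.
Proof.
apply: trivial_simple_line line1_fixed.
exact: vec_corner_neq0 incl1_isometry.
Qed.

Lemma line2_trivial_simple : trivial_simple nat_rep line2.
Proof.
apply: trivial_simple_line line2_fixed.
exact: vec_corner_neq0 incl2_isometry.
Qed.

Lemma line1_iso_line2 : mx_iso nat_rep line1 line2.
Proof.
have [sim1 fix1] := line1_trivial_simple; have [sim2 _] := line2_trivial_simple.
(* The rank-one map sending [vec e1] to [d1] times [vec e2]; it intertwines because both vectors are
   fixed. *)
pose f := (vec e1)^T *m vec e2.
have e1f : vec e1 *m f = d1%:R *: vec e2.
  rewrite mulmxA [_ *m _^T]mx11_scalar vec_dot mul_scalar_mx corner_tr.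
  by rewrite (corner_idem incl1_isometry) /e1 mxtrace_mulC incl1_isometry mxtrace1.
apply: (mx_Schur_iso sim1 sim2) (_ : _ <= dom_hom_mx _ f)%MS _ _.
- rewrite genmxE; apply/hom_mxP => g Gg.
  rewrite (rfix_mxP G line1_fixed) // e1f -scalemxAl.
  by rewrite (rfix_mxP G line2_fixed).
- by rewrite (eqmxMr _ (genmxE _)) e1f genmxE scalemx_sub.
- rewrite -mxrank_eq0 (eqmxMr _ (genmxE _)) mxrank_eq0 e1f scaler_eq0 negb_or.
  by rewrite pnatr_eq0 -lt0n d1_gt0 (vec_corner_neq0 d2_gt0 incl2_isometry).
Qed.

(** * The trivial isotypic component *)

Section TrivialComponent.
Hypothesis U1_commutant : forall A : 'M[C]_d1,
  (forall b, U1 b *m A *m (U1 b) ^t* = A) -> is_scalar_mx A.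
Hypothesis U2_commutant : forall A : 'M[C]_d2,
  (forall b, U2 b *m A *m (U2 b) ^t* = A) -> is_scalar_mx A.

Lemma fixed_sub_lines : (rfix_mx nat_rep G <= line1 + line2)%MS.
Proof.
apply/rV_subP => v; rewrite -(unvecK v); move: (unvec v) => A /[dup] fixv.
move=> /vec_fixedP fixA.
have EA : A = block_mx (ulsubmx A) 0 0 (drsubmx A).
  apply: block_sign_fixed; have [g Gg <-] := rG_block_sign.
  by have [x ->] := rG_inv_block Gg.
have Aconj b : block_mx (U1 b *m ulsubmx A *m (U1 b)^t*) 0 0
    (U2 b *m drsubmx A *m (U2 b)^t*) = A.
  have := fixA (b, false); rewrite {1}EA /signed_block /= expr0 scale1r.
  rewrite tr_block_mx map_block_mx !trmx0 !map_mx0 !mulmx_block.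
  by rewrite !(mul0mx, mulmx0, addr0, add0r).
have /is_scalar_mxP[a Ea] : is_scalar_mx (ulsubmx A).
  by apply: U1_commutant => b; have := Aconj b; rewrite [RHS]EA => /eq_block_mx[].
have /is_scalar_mxP[c Ec] : is_scalar_mx (drsubmx A).
  by apply: U2_commutant => b; have := Aconj b; rewrite [RHS]EA => /eq_block_mx[].
have -> : vec A = a *: vec e1 + c *: vec e2.
  rewrite -[c *: _]addr0 -vec0 -vec_linear -vec_linear addr0; congr vec.
  rewrite incl1_corner incl2_corner EA Ea Ec !scale_block_mx add_block_mx.
  by rewrite !scaler0 !scalemx1 !addr0 add0r.
apply: addmx_sub_adds; rewrite genmxE; exact: scalemx_sub.
Qed.

Lemma trivial_component :
  (component_mx nat_rep line1 :=: line1 + line2)%MS.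
Proof.
have [sim1 fix1] := line1_trivial_simple.
apply/eqmxP/andP; split; last first.
  rewrite addsmx_sub component_mx_id //=.
  exact: mx_iso_component line1_iso_line2.
(* The component is a sum of copies of [line1], each fixed pointwise because [line1] is. *)
have [I [W isoW ->]] := component_mx_def sim1.
apply/sumsmx_subP => i _; apply: submx_trans fixed_sub_lines.
by apply: mx_iso_rfix (isoW i) fix1.
Qed.

End TrivialComponent.

(** * The isotypic component of the traceless part of the first block *)

Section TracelessComponent.
Hypothesis U1_orbits : forall A X : 'M[C]_d1, ~~ is_scalar_mx A ->
  (forall b, \tr (X *m (U1 b *m A *m (U1 b) ^t*)) = 0) -> is_scalar_mx X.
Hypothesis U2_orbits : forall A X : 'M[C]_d2, ~~ is_scalar_mx A ->
  (forall b, \tr (X *m (U2 b *m A *m (U2 b) ^t*)) = 0) -> is_scalar_mx X.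
Hypotheses (d1_gt1 : (1 < d1)%N) (d1_neq_d2 : d1 != d2).

Lemma act_in_U1 g : g \in G -> exists b, forall A0 : 'M[C]_d1,
  rG g^-1%g *m (incl1 *m A0 *m incl1^T) *m (rG g^-1%g) ^t* =
  incl1 *m (U1 b *m A0 *m (U1 b) ^t*) *m incl1^T.
Proof.
by move=> /rG_inv_block[x ->]; exists x.1 => A0; exact: signed_block_conj1.
Qed.

Lemma U1_in_act b : exists2 g, g \in G & forall A0 : 'M[C]_d1,
  rG g^-1%g *m (incl1 *m A0 *m incl1^T) *m (rG g^-1%g) ^t* =
  incl1 *m (U1 b *m A0 *m (U1 b) ^t*) *m incl1^T.
Proof.
have [g Gg gE] := rG_block (b, false); exists g => // A0.
by rewrite gE signed_block_conj1.
Qed.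

Lemma act_in_U2 g : g \in G -> exists b, forall A0 : 'M[C]_d2,
  rG g^-1%g *m (incl2 *m A0 *m incl2^T) *m (rG g^-1%g) ^t* =
  incl2 *m (U2 b *m A0 *m (U2 b) ^t*) *m incl2^T.
Proof.
by move=> /rG_inv_block[x ->]; exists x.1 => A0; exact: signed_block_conj2.
Qed.

Lemma U2_in_act b : exists2 g, g \in G & forall A0 : 'M[C]_d2,
  rG g^-1%g *m (incl2 *m A0 *m incl2^T) *m (rG g^-1%g) ^t* =
  incl2 *m (U2 b *m A0 *m (U2 b) ^t*) *m incl2^T.
Proof.
have [g Gg gE] := rG_block (b, false); exists g => // A0.
by rewrite gE signed_block_conj2.
Qed.

Lemma traceless1_simple : mxsimple nat_rep (traceless_mx incl1).
Proof.
exact: (traceless_simple incl1_isometry incl1_real U1_unitary act_in_U1 U1_in_act).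
Qed.

(** Guarantees that every copy of this module meets a hyperplane nontrivially. *)
Lemma traceless1_rank_gt1 : (1 < \rank (traceless_mx incl1))%N.
Proof.
rewrite (rank_traceless_mx incl1_isometry incl1_real d1_gt0) -subn1 ltn_subRL.
by apply: (@leq_trans (2 * 2)); rewrite ?leq_mul.
Qed.

(** [block_sign] acts trivially on the first corner, and a module isomorphism transports this to
    [V]. *)
Lemma traceless1_sign_trivial (V : 'M[C]_((d1 + d2) * (d1 + d2))) :
  mx_iso nat_rep (traceless_mx incl1) V -> forall A, (vec A <= V)%MS ->
  block_sign *m A *m block_sign ^t* = A.
Proof.
move=> [f _ homf defV] A; rewrite -defV => /submxP[w Ew].
have [z Gz zE] := rG_block_sign.
apply: (can_inj (@vecK C _)); rewrite -zE -vec_natural Ew -!mulmxA; congr (_ *m _).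
rewrite mulmxA -(hom_mxP homf) //; congr (_ *m _).
apply/row_matrixP => i; rewrite row_mul.
have : (row i (traceless_mx incl1) <= traceless_mx incl1)%MS by rewrite row_sub.
rewrite -(unvecK (row i _)).
case/(sub_tracelessP incl1_isometry incl1_real) => A0 -> _.
rewrite vec_natural zE corner_block1 block_sign_conj.
by rewrite block_mxKul block_mxKur block_mxKdl block_mxKdr !oppr0.
Qed.

Lemma corner2_hom (W : 'M[C]_((d1 + d2) * (d1 + d2))) :
  (W <= dom_hom_mx nat_rep (corner_mx incl2))%MS.
Proof.
apply: (corner_mx_hom incl2_real) => g Gg.
by rewrite -[g]invgK; have [x ->] := rG_inv_block (groupVr Gg); exact: signed_block_comm2.
Qed.

(* A copy of the traceless part of the first corner cannot project nontrivially
   to the second corner, whose traceless part is zero or irreducible of a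
   different dimension and has codimension one. *)
Lemma traceless1_iso_corner2 (V : 'M[C]_((d1 + d2) * (d1 + d2))) :
  mx_iso nat_rep (traceless_mx incl1) V -> V *m corner_mx incl2 = 0.
Proof.
move=> isoV; apply/eqP/negPn/negP => nz.
have simV := mx_iso_simple isoV traceless1_simple.
(* By Schur, a nonzero compression is an isomorphism onto its image [I]. Since [I] has rank above 1,
   it contains nonzero traceless elements, and simplicity forces it to equal the traceless part of
   the second corner. *)
have isoI := mx_Schur_inj_iso simV (corner2_hom V) nz.
set I := V *m corner_mx incl2 in isoI nz.
have [modI nzI simI] := mx_iso_simple isoI simV.
have rI : \rank I = \rank (traceless_mx incl1).
  by rewrite -(mxrank_iso isoI) -(mxrank_iso isoV).
have modT2 := traceless_module incl2_isometry incl2_real U2_unitary act_in_U2.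
pose S := (I :&: traceless_mx incl2)%MS.
have modS : mxmodule nat_rep S by exact: capmx_module.
have nzS : S != 0.
  rewrite -mxrank_eq0 -lt0n -ltnS.
  have := rank_cap_ortho_ge incl2 I; rewrite rI => /(leq_trans traceless1_rank_gt1).
  move=> /leq_trans; apply; rewrite ltnS mxrankS // /S /traceless_mx sub_capmx capmxSl /=.
  by rewrite sub_capmx capmxSr andbT (submx_trans (capmxSl _ _)) // submxMl.
have sTI : (traceless_mx incl2 <= I)%MS.
  apply: submx_trans (capmxSl I (traceless_mx incl2)).
  exact: (traceless_sub_module incl2_isometry incl2_real U2_in_act U2_orbits modS
            (capmxSr _ _) nzS).
have sIT : (I <= traceless_mx incl2)%MS.
  apply: submx_trans (capmxSr I (traceless_mx incl2)).
  exact: simI modS (capmxSl _ _) nzS.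
have : \rank I = \rank (traceless_mx incl2).
  by apply/eqP; rewrite eqn_leq !mxrankS.
rewrite rI (rank_traceless_mx incl1_isometry incl1_real d1_gt0).
rewrite (rank_traceless_mx incl2_isometry incl2_real d2_gt0).
(* Equal ranks mean [(d1 * d1).-1 = (d2 * d2).-1]; both products are positive, so [d1 = d2]. *)
move/(congr1 succn); rewrite !prednK ?muln_gt0 ?d1_gt0 ?d2_gt0 // !mulnn.
by move/eqP; rewrite eqn_exp2r // (negPf d1_neq_d2).
Qed.

(** Each copy [V] lies in the first corner, where having rank above 1 makes it meet the traceless
    hyperplane; being simple, it lies inside that hyperplane. *)
Lemma traceless1_component : (component_mx nat_rep (traceless_mx incl1) <=
  traceless_mx incl1)%MS.
Proof.
have [I [W isoW ->]] := component_mx_def traceless1_simple.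
apply/sumsmx_subP => i _; move: (W i) (isoW i) => V isoV.
have [modV nzV simV] := mx_iso_simple isoV traceless1_simple.
have sV1 : (V <= corner_mx incl1)%MS.
  apply/rV_subP => v; rewrite -(unvecK v); move: (unvec v) => A sAV.
  have EA := block_sign_fixed (traceless1_sign_trivial isoV sAV).
  have A2 : vec A *m corner_mx incl2 = 0.
    by case/submxP: sAV => w ->; rewrite -mulmxA traceless1_iso_corner2 ?mulmx0.
  apply/(sub_cornerP incl1_isometry); exists (ulsubmx A).
  rewrite corner_block1 {1}EA; congr block_mx.
  move: A2; rewrite vec_corner_mx -/e2 incl2_corner => /(congr1 (@unvec C _)).
  rewrite vecK -vec0 vecK {1}EA !mulmx_block.
  rewrite !(mul1mx, mul0mx, mulmx0, mulmx1, addr0, add0r).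
  by rewrite -[RHS]block_mx0 => /eq_block_mx[].
have modT1 := traceless_module incl1_isometry incl1_real U1_unitary act_in_U1.
pose S := (V :&: traceless_mx incl1)%MS.
have modS : mxmodule nat_rep S by exact: capmx_module.
apply: submx_trans (capmxSr V (traceless_mx incl1)).
apply: simV modS (capmxSl _ _) _.
rewrite -mxrank_eq0 -lt0n -ltnS.
have := rank_cap_ortho_ge incl1 V; rewrite -(mxrank_iso isoV).
move=> /(leq_trans traceless1_rank_gt1) /leq_trans; apply; rewrite ltnS mxrankS //.
rewrite /S /traceless_mx sub_capmx capmxSl /=.
by rewrite sub_capmx capmxSr andbT (submx_trans (capmxSl _ _)).
Qed.

End TracelessComponent.

End TwoBlocks.

Local Open Scope complex_scope.

Theorem mainTheorem7 (R : realType) (d1 d2 : nat)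
    (d1_ge2 : (2 <= d1)%N) (d2_ge1 : (1 <= d2)%N)
    (mu1 : probability (borel_mx R d1) R) (haar1 : is_haar mu1)
    (mu2 : probability (borel_mx R d2) R) (haar2 : is_haar mu2)
    (B : finType) (U1 : B -> 'M[R[i]]_d1) (U2 : B -> 'M[R[i]]_d2)
    (U1_unitary : forall b, U1 b \is unitarymx)
    (U2_unitary : forall b, U2 b \is unitarymx)
    (U_inj : injective (block_unitary U1 U2))
    (gT : finGroupType) (G : {group gT})
    (rG : mx_representation R[i] G (d1 + d2))
    (rG_faithful : mx_faithful rG)
    (rG_image : forall M : 'M[R[i]]_(d1 + d2),
       (exists2 g, g \in G & rG g = M) <-> (exists x, block_unitary U1 U2 x = M))
    (design1 : unitary_design mu1 1 U1 /\ unitary_design mu2 1 U2) :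
  let nat_rep := colmod_repr (natural_repr rG) in
  [/\ trivial_simple nat_rep (line1 R d1 d2),
      trivial_simple nat_rep (line2 R d1 d2),
      (forall W, trivial_simple nat_rep W -> (W <= line1 R d1 d2 + line2 R d1 d2)%MS)
    & (component_mx nat_rep (line1 R d1 d2) :=: line1 R d1 d2 + line2 R d1 d2)%MS]
  /\
  (unitary_design mu1 2 U1 /\ unitary_design mu2 2 U2 -> d1 != d2 ->
   exists simH : mxsimple nat_rep (H1perp R d1 d2), multiplicity simH = 1%N).
Proof.
have d1_gt0 : (0 < d1)%N := ltnW d1_ge2.
set e1 := incl1 R[i] d1 d2 *m (incl1 R[i] d1 d2)^T.
set e2 := incl2 R[i] d1 d2 *m (incl2 R[i] d1 d2)^T.
(* The subspaces of the statement are instances of the corner construction for the two block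
   inclusions. *)
have line1E : line1 R d1 d2 = <<vec e1>>%MS.
  by rewrite vec.unlock /e1 incl1_corner.
have line2E : line2 R d1 d2 = <<vec e2>>%MS.
  by rewrite vec.unlock /e2 incl2_corner.
have H1perpE : H1perp R d1 d2 = traceless_mx (incl1 R[i] d1 d2).
  by rewrite /traceless_mx /corner_mx vec.unlock incl1_corner.
have B_gt0 := U_index_gt0 rG_image.
have com1 A := @design1_commutant_scalar R d1 mu1 B U1 haar1 A design1.1 B_gt0.
have com2 A := @design1_commutant_scalar R d2 mu2 B U2 haar2 A design1.2 B_gt0.
rewrite line1E line2E H1perpE; split.
  split.
  - exact (line1_trivial_simple U1_unitary rG_image d1_gt0).
  - exact (line2_trivial_simple U2_unitary rG_image d2_ge1).
  - move=> W [_ fixW]; exact (submx_trans fixW (fixed_sub_lines rG_image com1 com2)).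
  - exact (trivial_component U1_unitary U2_unitary rG_image d1_gt0 d2_ge1 com1 com2).
move=> [des1 des2] d12.
have orb1 A X := @design2_annihilator_scalar R d1 mu1 B U1 haar1 A X des1 B_gt0.
have orb2 A X := @design2_annihilator_scalar R d2 mu2 B U2 haar2 A X des2 B_gt0.
have simH := traceless1_simple U1_unitary rG_image orb1 d1_ge2.
exists simH; apply: multiplicity_component_eq.
exact (traceless1_component U1_unitary U2_unitary rG_image d1_gt0 d2_ge1
  orb1 orb2 d1_ge2 d12).
Qed.
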